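(* Let $F,G:\mathbb R\times\mathbb R\to\mathbb R$ be $$F(x,y)=x-y,\qquad G(x,y)=-|x-y|\cdot\mathrm{sign}(y)+y,\qquad \mathrm{sign}(y)=1_{y>0}-1_{y<0},$$ so that the unique solution of $F(x,y)=0$ in $x$ is $H(y)=y$ and the unique root pair is $(x^\star,y^\star)=(0,0)$. Consider the iteration $$x_{t+1}=x_t-\alpha_t(F(x_t,y_t)+\xi_t),\qquad y_{t+1}=y_t-\beta_t(G(x_t,y_t)+\psi_t),\qquad t\ge0.$$ Suppose that: (a) $\psi_t=0$ for all $t$, and the $\xi_t$ are i.i.d. with $\mathbb E\xi_t=0$ and $\mathbb E\xi_t^2=\Sigma_1>0$; (b) the step sizes $\alpha_t,\beta_t>0$ satisfy $\beta_t/\alpha_t\to0$ together with: $\alpha_t\le\frac1{12}$, $\beta_t\le\frac1{14}$, $\frac{\beta_t}{\alpha_t}\le\frac1{200}$, $\frac{\beta_t^2}{\alpha_t}\le\frac1{200}$ for all $t$; $1\le\frac{\alpha_{t-1}}{\alpha_t}\le1+\frac{\alpha_t}{16}\wedge\frac{\beta_t}{16}$ and $1\le\frac{\beta_{t-1}}{\beta_t}\le1+\frac{\beta_t}{64}$ for all $t\ge1$; $\beta_t/\alpha_t$ is non-increasing in $t$; and $\prod_{\tau=0}^t\big(1-\frac{\beta_\tau}{4}\big)=O(\alpha_t^2)$; (c) the initialization satisfies $y_0\ne y^\star=0$. Then, with $\hat x_t=x_t-H(y_t)=x_t-y_t$ and $\hat y_t=y_t-y^\star=y_t$, $$\mathbb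 E|\hat x_t|^2=\Omega(\alpha_t)\qquad\text{and}\qquad \mathbb E|\hat y_t|^2=\Omega(\alpha_t).$$
   Context: $a\wedge b=\min\{a,b\}$. The initial points $x_0,y_0\in\mathbb R$ are otherwise arbitrary. For nonnegative sequences, $u_t=\Omega(\alpha_t)$ means that there are $c>0$ and $t_0$ with $u_t\ge c\,\alpha_t$ for all $t\ge t_0$, and $u_t=O(\alpha_t^2)$ means $u_t\le C\alpha_t^2$ for all $t$ with some constant $C$. The conditions in (b) are the paper's general step-size conditions specialized to this example, in which all Lipschitz and strong monotonicity constants equal $1$, $d_x=d_y=1$, and the exponents $\delta_F,\delta_G$ are set to $1$. *)

(* Defs.v *)
From HB Require Import structures.
From mathcomp Require Import all_boot all_order all_algebra.
From mathcomp Require Import all_classical all_reals all_analysis.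
Set Implicit Arguments.
Unset Strict Implicit.
Unset Printing Implicit Defensive.
Import Order.TTheory GRing.Theory Num.Theory.
Import numFieldNormedType.Exports.
Local Open Scope classical_set_scope.
Local Open Scope ring_scope.

Definition F {R : realType} (x y : R) : R := x - y.

(* [Num.sg y] is 1, 0, -1 according to the sign of [y]. *)
Definition G {R : realType} (x y : R) : R := - (`|x - y| * Num.sg y) + y.

Definition H {R : realType} (y : R) : R := y.

Definition xstar {R : realType} : R := 0.
Definition ystar {R : realType} : R := 0.

Lemma F_eq0 {R : realType} (x y : R) : F x y = 0 <-> x = H y.
Proof.
rewrite /F /H; split; last by move=> ->; rewrite subrr.
by move/eqP; rewrite subr_eq0 => /eqP.
Qed.

Lemma FG_eq0 {R : realType} (x y : R) :
  (F x y = 0 /\ G x y = 0) <-> (x = xstar /\ y = ystar).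
Proof.
rewrite F_eq0 /H /G /xstar /ystar; split=> [[-> ]|[-> ->]].
  by rewrite subrr normr0 mul0r oppr0 add0r.
by split=> //; rewrite subrr normr0 mul0r oppr0 add0r.
Qed.

Section iid.
Context {d : measure_display} {T : measurableType d} {R : realType}.
Variable P : probability T R.

Definition mutually_independent (X : nat -> {RV P >-> R}) : Prop :=
  forall (J : seq nat) (B : nat -> set R),
    uniq J -> (forall j, j \in J -> measurable (B j)) ->
    P (\bigcap_(j in [set` J]) (X j @^-1` B j)) =
    (\prod_(j <- J) P (X j @^-1` B j))%E.

(* Equality of the laws is only required on Borel sets: the values of a measure
   on non-measurable sets carry no information. *)
Definition identically_distributed (X : nat -> {RV P >-> R}) : Prop :=
  forall (i j : nat) (B : set R), measurable B ->
    distribution P (X i) B = distribution P (X j) B.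

Definition iid (X : nat -> {RV P >-> R}) : Prop :=
  mutually_independent X /\ identically_distributed X.

(* [fine] maps [+oo] to 0, so a positive lower bound on [mean_square X] also
   asserts that the expectation is finite. *)
Definition mean_square (X : T -> R) : R :=
  fine ('E_P[(fun w => (`|X w| ^+ 2)%R)])%E.

End iid.

Definition is_Omega {R : realType} (u a : nat -> R) : Prop :=
  exists2 c : R, 0 < c & exists t0 : nat,
    forall t : nat, (t0 <= t)%N -> c * a t <= u t.

Definition is_O {R : realType} (u a : nat -> R) : Prop :=
  exists C : R, forall t : nat, u t <= C * a t.

(* Main.v *)
Require Import Defs.
From HB Require Import structures.
From mathcomp Require Import all_boot all_order all_algebra.
From mathcomp Require Import all_classical all_reals all_analysis.
From mathcomp Require Import measurable_realfun ring lra.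
Set Implicit Arguments.
Unset Strict Implicit.
Unset Printing Implicit Defensive.
Import Order.TTheory GRing.Theory Num.Theory.
Import numFieldNormedType.Exports.
Local Open Scope classical_set_scope.
Local Open Scope ring_scope.

(** The slow iterate never changes sign, so [z = |y|] satisfies the linear
    recursion [z' = (1 - beta) z + beta |xh|] with [xh = x - y], while
    [xh' = m - alpha * xi] with a drift [m] that is independent of the current
    noise and differs from [(1 - alpha) xh] by at most [beta (z + |xh|)].
    A joint induction gives [E xh^2 = O(alpha)] and [E z^2 = O(alpha)].

    Only second moments of the noise are available, so the first moment of [xh]
    is bounded below through the Huber function of radius [s = K sqrt(alpha)]:
    it is convex, dominated by [2 s |xh|], and equal to the square near 0.  As
    [E m^2 = O(s^2)], one noise step raises its expectation by a multiple of
    [alpha^2] (the part of the noise truncated at a fixed level suffices),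
    whereas the coupling costs only [O(alpha * beta) = o(alpha^2)].  This gives
    [E |xh| >= c sqrt(alpha)], the linear recursion passes this bound on to
    [E z], and both claims follow from [(E f)^2 <= E f^2]. *)

(** * The Huber function and scalar recursions *)

Section huber.
Context {R : realType}.
Implicit Types s x y m n q a u c M : R.

(** Twice the usual Huber loss: exactly the square on [[-s, s]], with slope of modulus [2 * s]
    outside. *)
Definition huber s x : R := x ^+ 2 - Num.max (`|x| - s) 0 ^+ 2.

(** Half the derivative of [huber s]. *)
Definition clip s x : R := Num.max (- s) (Num.min s x).

Definition trunc_sqr M x : R := if `|x| <= M then x ^+ 2 else 0.

Lemma huber_le_sqr s x : huber s x <= x ^+ 2.
Proof. by rewrite /huber; nra. Qed.

Variant huber_spec s x : R -> Type :=
| HuberMid of - s <= x & x <= s : huber_spec s x (x ^+ 2)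
| HuberPos of s < x : huber_spec s x (2 * s * x - s ^+ 2)
| HuberNeg of x < - s : huber_spec s x (- (2 * s * x) - s ^+ 2).

Lemma huberP s x : 0 < s -> huber_spec s x (huber s x).
Proof.
move=> s0; rewrite /huber; case: (leP `|x| s) => [|sx].
  rewrite ler_norml => /andP[sx xs].
  rewrite max_r; last by rewrite subr_le0 ler_norml sx.
  by rewrite expr0n subr0; constructor.
rewrite max_l; last by rewrite subr_ge0 ltW.
case: (leP 0 x) => x0.
  rewrite ger0_norm // in sx *.
  by rewrite (_ : _ - _ = 2 * s * x - s ^+ 2); [constructor|ring].
rewrite ltr0_norm // in sx *.
rewrite (_ : _ - _ = - (2 * s * x) - s ^+ 2); last by ring.
by constructor; lra.
Qed.

Lemma huber_ge0 s x : 0 < s -> 0 <= huber s x.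
Proof. by move=> s0; case: huberP => // *; nra. Qed.

Lemma huber_le_norm s x : 0 < s -> huber s x <= 2 * s * `|x|.
Proof.
move=> s0; have := ler_norm x; have := ler_norm (- x); rewrite normrN.
by case: huberP => // *; nra.
Qed.

Lemma huber_lipschitz s x y : 0 < s ->
  huber s x <= huber s y + 2 * s * `|x - y|.
Proof.
move=> s0; have := ler_norm (x - y); have := ler_norm (- (x - y)).
rewrite normrN; set n := `|_|.
case: (huberP x s0) => // *; case: (huberP y s0) => // *; nra.
Qed.

(** The left-hand side is the tangent at [u] of the square, and [huber s] is the upper envelope of
    these tangents for [u] in [[-s, s]]. Scaling, change of radius and convexity all follow by a
    suitable choice of [u]. *)
Lemma huber_ge s u x : 0 < s -> - s <= u <= s ->
  2 * u * x - u ^+ 2 <= huber s x.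
Proof.
move=> s0 /andP[u1 u2]; case: (huberP x s0) => [_ _|sx|xs].
- by have := sqr_ge0 (x - u); nra.
- have : 0 <= (s - u) * (2 * x - s - u) by rewrite mulr_ge0; lra.
  by nra.
- have : 0 <= (s + u) * (- (2 * x) - s + u) by rewrite mulr_ge0; lra.
  by nra.
Qed.

(** The tangent at [u], multiplied by [c ^+ 2], is the tangent at [c * u] evaluated at [c * x], and
    [c * u] stays in [[-s, s]]. *)
Lemma huber_scale s c x : 0 < s -> 0 <= c <= 1 ->
  c ^+ 2 * huber s x <= huber s (c * x).
Proof.
move=> s0 /andP[c0 c1].
have ge u : - s <= u <= s -> c ^+ 2 * (2 * u * x - u ^+ 2) <= huber s (c * x).
  move=> /andP[u1 u2]; apply: le_trans (huber_ge (u := c * u) (c * x) s0 _).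
    by rewrite -subr_ge0; nra.
  by apply/andP; split; nra.
case: (huberP x s0) => [x1 x2|_|_].
- by have := ge x; rewrite x1 x2 => /(_ isT); nra.
- by have := ge s; rewrite lexx andbT => /(_ _); nra.
- by have := ge (- s); rewrite lexx => /(_ _); nra.
Qed.

(** The tangent at [u] for radius [s] is compared with the tangent at [u * s' / s] for radius [s'];
    the sign of [u * x] decides the comparison. This serves to pass from one radius to the next
    while the step size shrinks. *)
Lemma huber_radius s s' x : 0 < s' -> s' <= s ->
  s' ^+ 2 * huber s x <= s ^+ 2 * huber s' x.
Proof.
move=> s0 ss'; have s1 : 0 < s by lra.
have ge u : - s <= u <= s -> 0 <= u * x ->
    s' ^+ 2 * (2 * u * x - u ^+ 2) <= s ^+ 2 * huber s' x.
  move=> /andP[u1 u2] ux; pose r := s' / s.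
  have r0 : 0 < r by rewrite divr_gt0.
  have s'E : s' = r * s by rewrite /r divfK// gt_eqF.
  have r1 : r <= 1 by rewrite /r ler_pdivrMr// mul1r.
  have := huber_ge (u := r * u) x s0; rewrite s'E => /(_ _)/wrap[|ge].
    by apply/andP; split; nra.
  apply: (@le_trans _ _ (s ^+ 2 * (2 * (r * u) * x - (r * u) ^+ 2))).
    have : 0 <= s ^+ 2 * (r * (1 - r) * (u * x)).
      by rewrite mulr_ge0 ?sqr_ge0// mulr_ge0// mulr_ge0 ?subr_ge0// ltW.
    by lra.
  by rewrite ler_wpM2l ?sqr_ge0.
case: (huberP x s1) => [x1 x2|sx|xs].
- by have := ge x; rewrite x1 x2 -expr2 sqr_ge0 => /(_ isT isT); nra.
- by have := ge s; rewrite lexx andbT => /(_ _ _); apply; nra.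
- have := ge (- s); rewrite lexx => /(_ _ _)/wrap[||+]; [lra|nra|].
  by rewrite sqrrN mulrN mulNr.
Qed.

Lemma clip_bound s x : 0 < s -> - s <= clip s x <= s.
Proof.
move=> s0; rewrite /clip; apply/andP; split; first by rewrite le_max lexx.
by rewrite ge_max ge_min lexx andbT; lra.
Qed.

Lemma huberE s x : 0 < s -> huber s x = 2 * clip s x * x - clip s x ^+ 2.
Proof.
move=> s0; rewrite /clip; case: (huberP x s0) => [x1 x2|sx|xs].
- by rewrite (min_r x2) (max_r x1); ring.
- by rewrite min_l ?ltW// max_r//; lra.
- rewrite min_r; last by lra.
  by rewrite max_l ?ltW//; ring.
Qed.

Lemma huber_convex s m n : 0 < s ->
  huber s m + 2 * clip s m * n <= huber s (m + n).
Proof.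
move=> s0; have := huber_ge (m + n) s0 (clip_bound m s0).
by rewrite (huberE m)//; lra.
Qed.

(* [1 - 4 m^2 / s^2] minorizes the indicator function of [|m| <= s / 2], where
   the Huber function is exactly quadratic. *)
Lemma huber_expand s M a m q : 0 < s -> 0 <= a -> a * M <= s / 2 ->
  huber s m - 2 * clip s m * a * q
    + a ^+ 2 * trunc_sqr M q * (1 - 4 * m ^+ 2 / s ^+ 2)
  <= huber s (m - a * q).
Proof.
move=> s0 a0 aM; have s2 : 0 < s ^+ 2 by rewrite exprn_gt0.
have cvx : huber s m - 2 * clip s m * a * q <= huber s (m - a * q).
  by apply: le_trans (huber_convex m (- (a * q)) s0); nra.
have tr0 : 0 <= trunc_sqr M q by rewrite /trunc_sqr; case: ifP => // _; rewrite sqr_ge0.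
have [ms|sm] := leP (4 * m ^+ 2) (s ^+ 2); last first.
  apply: le_trans cvx; rewrite gerDl; apply: mulr_ge0_le0.
    by rewrite mulr_ge0 ?sqr_ge0.
  by rewrite subr_le0 ler_pdivlMr// mul1r ltW.
rewrite /trunc_sqr in tr0 *; case: (leP `|q| M) => qM; last first.
  by rewrite mulr0 mul0r addr0.
(* Both [m] and [a * q] are at most [s / 2] in modulus, so [m] and [m - a * q] lie in the quadratic
   region. *)
have /andP[m1 m2] : - (s / 2) <= m <= s / 2.
  by rewrite -ler_norml -ler_sqr ?nnegrE ?divr_ge0 ?(ltW s0)// real_normK ?num_real//; nra.
have /andP[q1 q2] : - (s / 2) <= a * q <= s / 2.
  by rewrite -ler_norml normrM ger0_norm//; apply: le_trans aM; rewrite ler_wpM2l.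
rewrite /clip min_r ?max_r; try lra.
have -> : huber s m = m ^+ 2 by case: (huberP m s0) => *; lra.
have -> : huber s (m - a * q) = (m - a * q) ^+ 2.
  by case: (huberP (m - a * q) s0) => *; lra.
have : 0 <= a ^+ 2 * q ^+ 2 * (4 * m ^+ 2 / s ^+ 2).
  by rewrite mulr_ge0 ?(mulr_ge0 (sqr_ge0 _) (sqr_ge0 _))// divr_ge0 ?sqr_ge0//
    mulr_ge0 ?sqr_ge0.
by nra.
Qed.

End huber.

Section sequences.
Context {R : realType}.
Implicit Types a b X Y : nat -> R.

(** In both recursions the contraction has to outweigh the coupling and the decrease from [a t] to
    [a t.+1]. The constant [2 * D] for [Y] leaves a margin [b t * D * a t] over the input from [X],
    of which the decrease of [a] takes only an eighth. *)
Lemma upper_recursion a b X Y S D :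
  (forall t, 0 < a t) -> (forall t, 0 < b t) ->
  (forall t, 200 * b t <= a t) -> (forall t, a t <= 1 / 12) ->
  (forall t, a t * (1 - a t / 16) <= a t.+1) ->
  (forall t, a t * (1 - b t / 16) <= a t.+1) ->
  (forall t, X t.+1 <= (1 - a t) * X t + b t / 100 * (X t + Y t) + a t ^+ 2 * S) ->
  (forall t, Y t.+1 <= (1 - b t) * Y t + b t * X t) ->
  0 <= D -> 2 * S <= D -> X 0%N <= D * a 0%N -> Y 0%N <= 2 * D * a 0%N ->
  forall t, X t <= D * a t /\ Y t <= 2 * D * a t.
Proof.
move=> a0 b0 ab a12 aa ba Xr Yr D0 SD X0 Y0.
have SD2 : S <= D / 2 by clear -SD; lra.
elim=> // t [IX IY].
have ab100 : b t / 100 <= a t / 20000 by have := ab t; clear; lra.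
have aD0 : 0 <= 3 * D * a t by rewrite !mulr_ge0// ltW.
have a_le1 : 0 <= 1 - a t by have := a12 t; clear; lra.
have b_le1 : 0 <= 1 - b t by have := ab t; have := a12 t; have := a0 t; clear; lra.
split.
  apply: (le_trans (Xr t)); apply: (@le_trans _ _ (D * (a t * (1 - a t / 16)))).
    2: by rewrite ler_wpM2l.
  have h1 : (1 - a t) * X t <= (1 - a t) * (D * a t) by rewrite ler_wpM2l.
  have h2 : b t / 100 * (X t + Y t) <= a t / 20000 * (3 * D * a t).
    apply: (@le_trans _ _ (b t / 100 * (3 * D * a t))).
      rewrite ler_wpM2l ?divr_ge0 ?(ltW (b0 t))//.
      by clear -IX IY; lra.
    by rewrite ler_wpM2r.
  have h3 : a t ^+ 2 * S <= a t ^+ 2 * (D / 2) by rewrite ler_wpM2l ?sqr_ge0.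
  have h4 : 0 <= D * a t ^+ 2 by rewrite mulr_ge0 ?sqr_ge0.
  by clear -h1 h2 h3 h4; lra.
apply: (le_trans (Yr t)); apply: (@le_trans _ _ (2 * D * (a t * (1 - b t / 16)))).
  2: by rewrite ler_wpM2l// mulr_ge0.
have h1 : (1 - b t) * Y t <= (1 - b t) * (2 * D * a t) by rewrite ler_wpM2l.
have h2 : b t * X t <= b t * (D * a t) by rewrite ler_wpM2l// ltW.
have h4 : 0 <= D * (a t * b t) by rewrite mulr_ge0// mulr_ge0 ?(ltW (a0 t)) ?(ltW (b0 t)).
by clear -h1 h2 h4; lra.
Qed.

(** A single step preserves the bound for every constant up to [k], so the ratio at time [t0],
    capped at [k], propagates unchanged. *)
Lemma lower_recursion (r u : nat -> R) (k : R) t0 :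
  (forall t, 0 < r t) -> (forall t, r t.+1 <= r t) -> 0 < k -> 0 < u t0 ->
  (forall t, (t0 <= t)%N -> forall c, 0 < c -> c <= k -> c * r t <= u t ->
     c * r t.+1 <= u t.+1) ->
  exists2 c : R, 0 < c & forall t, (t0 <= t)%N -> c * r t <= u t.
Proof.
move=> r0 rd k0 u0 step; pose c := Num.min k (u t0 / r t0).
have c0 : 0 < c by rewrite lt_min k0 divr_gt0.
exists c => //; elim=> [|t IH] t0t.
  have -> : 0%N = t0 by apply/eqP; rewrite eq_sym -leqn0.
  by rewrite -ler_pdivlMr// ge_min lexx orbT.
move: t0t; rewrite leq_eqVlt => /predU1P[<-|t0t].
  by rewrite -ler_pdivlMr// ge_min lexx orbT.
by apply: step => //; [rewrite ge_min lexx|exact: IH].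
Qed.

End sequences.

(** * Independence and square-integrable variables *)

Section independence.
Context {d : measure_display} {T : measurableType d} {R : realType}.
Variable P : probability T R.
Context {d1 d2 : measure_display}.
Context {T1 : measurableType d1} {T2 : measurableType d2}.

Definition indep (W : T -> T1) (U : T -> T2) : Prop := forall A B,
  measurable A -> measurable B ->
  P (W @^-1` A `&` U @^-1` B) = (P (W @^-1` A) * P (U @^-1` B))%E.

(** By independence the law of the pair and the product of the two laws agree on rectangles, hence
    everywhere. Tonelli then allows integrating over [U] with [W] frozen. *)
Lemma indep_tonelli (W : T -> T1) (U : T -> T2) (k : T1 * T2 -> \bar R) :
  measurable_fun setT W -> measurable_fun setT U -> indep W U ->
  measurable_fun setT k -> (forall z, 0 <= k z)%E ->
  (\int[P]_w k (W w, U w) = \int[P]_w \int[P]_w' k (W w, U w'))%E /\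
  measurable_fun setT (fun w => \int[P]_w' k (W w, U w'))%E.
Proof.
move=> mW mU WU mk k0.
pose W' : {mfun T >-> T1} := HB.pack W (isMeasurableFun.Build _ _ _ _ W mW).
pose U' : {mfun T >-> T2} := HB.pack U (isMeasurableFun.Build _ _ _ _ U mU).
have mWU : measurable_fun setT (fun w => (W w, U w)) by exact: measurable_fun_pair.
pose WU' : {mfun T >-> (T1 * T2)%type} :=
  HB.pack (fun w => (W w, U w)) (isMeasurableFun.Build _ _ _ _ _ mWU).
have E X : measurable X ->
    (distribution P W' \x distribution P U')%E X = distribution P WU' X.
  apply: product_measure_unique => A B mA mB.
  by rewrite /distribution/= /pushforward/= -WU.
have inner r : (\int[P]_w' k (r, U w') =
    fubini_F (distribution P U') k r)%E.
  rewrite /fubini_F ge0_integral_distribution//.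
  exact: measurableT_comp.
have mF : measurable_fun setT (fubini_F (distribution P U') k).
  exact: measurable_fun_fubini_tonelli_F.
split; last first.
  under eq_fun do rewrite inner.
  exact: (measurableT_comp mF).
transitivity (\int[distribution P WU']_z k z)%E.
  by rewrite ge0_integral_distribution.
transitivity (\int[(distribution P W' \x distribution P U')%E]_z k z)%E.
  by apply: eq_measure_integral => A mA _; exact/esym/E.
rewrite fubini_tonelli1// ge0_integral_distribution//.
  by apply: eq_integral => w _ /=; rewrite -inner.
by move=> r; apply: integral_ge0.
Qed.

End independence.

Section square_integrable.
Context {d : measure_display} {T : measurableType d} {R : realType}.
Variable P : probability T R.
Implicit Types f g h : T -> R.

Local Notation integ f := (P.-integrable [set: T] (EFin \o f)).

Lemma integ_dom f g : measurable_fun setT g -> integ f ->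
  (forall w, `|g w| <= f w) -> integ g.
Proof.
move=> mg fi gf; apply: le_integrable fi => //; first exact/measurable_EFinP.
by move=> w _; rewrite /= lee_fin; apply: le_trans (gf w) (ler_norm _).
Qed.

Lemma integ_cst (c : R) : integ (fun=> c).
Proof. exact: finite_measure_integrable_cst. Qed.

Lemma integD f g : integ f -> integ g -> integ (fun w => f w + g w).
Proof. exact: integrableD. Qed.

Lemma integZ (c : R) f : integ f -> integ (fun w => c * f w).
Proof. exact: integrableZl. Qed.

Lemma Rintegral_probability_cst (c : R) : \int[P]_w c = c.
Proof.
by rewrite Rintegral_cst// (congr1 fine (probability_setT P)) mulr1.
Qed.

Lemma EFin_Rintegral f : integ f ->
  ((\int[P]_w f w)%R%:E = \int[P]_w (f w)%:E)%E.
Proof. by move=> fi; rewrite fineK//; exact: integrable_fin_num. Qed.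

Definition sqint f := measurable_fun setT f /\ integ (fun w => f w ^+ 2).

Lemma sqint_quad (c : R) f g h : sqint f -> sqint g -> measurable_fun setT h ->
  (forall w, `|h w| <= c * (f w ^+ 2 + g w ^+ 2 + 1)) -> integ h.
Proof.
move=> [_ fi] [_ gi] mh hc; apply: integ_dom mh _ hc.
by apply: integZ; apply: integD; [exact: integD|exact: integ_cst].
Qed.

Lemma sqint_dom f g h : sqint f -> sqint g -> measurable_fun setT h ->
  (forall w, `|h w| <= `|f w| + `|g w|) -> sqint h.
Proof.
move=> sf sg mh hc; split => //.
apply: (sqint_quad (c := 2) sf sg); first exact: measurable_funX.
move=> w; rewrite ger0_norm ?sqr_ge0// -real_normK ?num_real//.
rewrite -(real_normK (num_real (f w))) -(real_normK (num_real (g w))).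
have := hc w; move: (normr_ge0 (h w)) (normr_ge0 (f w)) (normr_ge0 (g w)).
set a := `|h w|; set b := `|f w|; set e := `|g w| => a0 b0 e0 abe.
have : a ^+ 2 <= (b + e) ^+ 2 by rewrite lerXn2r ?nnegrE ?addr_ge0.
by have := sqr_ge0 (b - e); nra.
Qed.

Lemma sqint_cst (c : R) : sqint (fun=> c).
Proof. by split; [exact: measurable_cst|exact: integ_cst]. Qed.

Lemma sqint_integ f : sqint f -> integ f.
Proof.
move=> sf; apply: (sqint_quad (c := 1) sf (sqint_cst 0)); first exact: sf.1.
move=> w; rewrite -(real_normK (num_real (f w))).
by have := sqr_ge0 (`|f w| - 1); nra.
Qed.

(** Nonnegativity of the variance: the difference of the two sides is the integral of
    [(f w - e) ^+ 2], where [e] is the mean. *)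
Lemma sqr_Rintegral_le f : sqint f ->
  (\int[P]_w f w) ^+ 2 <= \int[P]_w (f w ^+ 2).
Proof.
move=> sf; set e := Rintegral _ _ _.
have fi := sqint_integ sf.
rewrite -subr_ge0.
have -> : \int[P]_w (f w ^+ 2) - e ^+ 2 =
    \int[P]_w (f w ^+ 2 + (- (2 * e) * f w + e ^+ 2)).
  rewrite !RintegralD//=; [|exact: integZ|exact: integ_cst|exact: sf.2|].
    rewrite RintegralZl// Rintegral_probability_cst -/e.
    by ring.
  by apply: integD; [exact: integZ|exact: integ_cst].
apply: Rintegral_ge0 => w _.
by have := sqr_ge0 (f w - e); nra.
Qed.

Section iterated.
Context {d1 d2 : measure_display}.
Context {T1 : measurableType d1} {T2 : measurableType d2}.

(** Real-valued form of [indep_tonelli]. Integrability of each section keeps [Rintegral] from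
    turning an infinite inner integral into 0. *)
Lemma indep_iterated (W : T -> T1) (U : T -> T2) (k : T1 * T2 -> R) :
  measurable_fun setT W -> measurable_fun setT U -> indep P W U ->
  measurable_fun setT k -> (forall z, 0 <= k z) ->
  integ (fun w => k (W w, U w)) -> (forall r, integ (fun w => k (r, U w))) ->
  integ (fun w => \int[P]_w' k (W w, U w')) /\
  \int[P]_w k (W w, U w) = \int[P]_w \int[P]_w' k (W w, U w').
Proof.
move=> mW mU WU mk k0 ki kri.
have [E mI] := indep_tonelli mW mU WU
  ((measurable_EFinP _ _).2 mk) (fun z => k0 z : (0 <= (k z)%:E)%E).
have inner w : (\int[P]_w' (EFin \o k) (W w, U w') =
    (\int[P]_w' k (W w, U w'))%R%:E)%E.
  by rewrite EFin_Rintegral.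
have eqk : (\int[P]_w (\int[P]_w' k (W w, U w'))%R%:E =
    (\int[P]_w k (W w, U w))%R%:E)%E.
  rewrite EFin_Rintegral//; symmetry; rewrite [LHS]E.
  by apply: eq_integral => w _; rewrite inner.
split; last by rewrite [RHS]/Rintegral eqk.
apply/integrableP; split.
  by apply: eq_measurable_fun mI => w _; rewrite inner.
under eq_integral do rewrite /= ger0_norm ?Rintegral_ge0//.
by rewrite eqk ltry.
Qed.

End iterated.

End square_integrable.

(** * Independence of the past from the current noise *)

Section history.
Context {d : measure_display} {T : measurableType d} {R : realType}.
Variable P : probability T R.
Variable xi : nat -> {RV P >-> R}.

(** An intersection-stable generator of the sigma-algebra of the noise strictly before time [t]. *)
Definition cylinder (t : nat) : set (set T) :=
  [set A | exists2 B : nat -> set R, (forall j, measurable (B j)) &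
     A = \bigcap_(j in [set` iota 0 t]) (xi j @^-1` B j)].

Definition adapted (t : nat) (f : T -> R) : Prop :=
  measurable_fun [set: g_sigma_algebraType (cylinder t)]
    (f : g_sigma_algebraType (cylinder t) -> R).

Lemma measurable_preimage_xi j (B : set R) :
  measurable B -> measurable (xi j @^-1` B).
Proof. by move=> mB; rewrite -[X in measurable X]setTI; exact: measurable_funPT. Qed.

Lemma adapted_cst t (c : R) : adapted t (fun=> c).
Proof. exact: measurable_cst. Qed.

Lemma adapted_ext t (f g : T -> R) : f =1 g -> adapted t f -> adapted t g.
Proof. by move=> /funext ->. Qed.

Lemma adaptedB t f g : adapted t f -> adapted t g ->
  adapted t (fun w => f w - g w).
Proof. exact: measurable_funB. Qed.

Lemma adaptedM t f g : adapted t f -> adapted t g ->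
  adapted t (fun w => f w * g w).
Proof. exact: measurable_funM. Qed.

Lemma adapted_norm t f : adapted t f -> adapted t (fun w => `|f w|).
Proof. by move=> af; exact: measurableT_comp. Qed.

Lemma cylinder_measurable t A : <<s cylinder t >> A -> measurable A.
Proof.
suff: <<s cylinder t >> `<=` @measurable _ T by exact.
apply: smallest_sub; first exact: sigma_algebra_measurable.
move=> _ [B mB ->]; apply: fin_bigcap_measurable => [|j _].
  exact: finite_seq.
exact: measurable_preimage_xi.
Qed.

Lemma adapted_measurable t f : adapted t f -> measurable_fun [set: T] f.
Proof. by move=> af _ B mB; apply: (@cylinder_measurable t); exact: af. Qed.

Lemma set_iotaE t : [set` iota 0 t] = [set j | (j < t)%N].
Proof. by apply/seteqP; split => j; rewrite /mkset mem_iota. Qed.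

Lemma cylinderS t : cylinder t `<=` cylinder t.+1.
Proof.
move=> _ [B mB ->]; exists (fun j => if (j < t)%N then B j else setT).
  by move=> j; case: ifP.
rewrite !set_iotaE; apply/seteqP; split => w wB j /= jt.
  by case: ifP => // jt'; exact: wB.
by have := wB j; rewrite /= jt; apply; exact: ltnW.
Qed.

Lemma adaptedS t f : adapted t f -> adapted t.+1 f.
Proof.
move=> af _ B mB; have : <<s cylinder t >> (setT `&` f @^-1` B) by exact: af.
by apply: sub_smallest2r (@cylinderS t) _; exact: smallest_sigma_algebra.
Qed.

Lemma adapted_xi t : adapted t.+1 (xi t).
Proof.
move=> _ B mB; rewrite setTI; apply: sub_sigma_algebra.
exists (fun j => if j == t then B else setT); first by move=> j; case: ifP.
rewrite set_iotaE; apply/seteqP; split => w /= wB => [j _|].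
  by case: eqP => // ->.
by have := wB t; rewrite /= eqxx; apply.
Qed.

Hypothesis xi_indep : mutually_independent xi.

(** Dynkin's argument: the events satisfying the product rule with [xi t] form a lambda-system, and
    it contains the cylinders, which are stable under intersection. *)
Lemma history_indep t A B : <<s cylinder t >> A -> measurable B ->
  P (A `&` xi t @^-1` B) = (P A * P (xi t @^-1` B))%E.
Proof.
move=> cA mB; have mxB := measurable_preimage_xi t mB.
pose H : set (set T) := [set A | measurable A /\
  P (A `&` xi t @^-1` B) = (P A * P (xi t @^-1` B))%E].
suff: <<s cylinder t >> `<=` H by move=> /(_ _ cA)[].
apply: lambda_system_subset; [| | |by []].
- move=> _ _ [B1 mB1 ->] [B2 mB2 ->]; exists (fun j => B1 j `&` B2 j).
    by move=> j; exact: measurableI.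
  by rewrite -bigcapI.
- apply/dynkin_lambda_system; split.
  + by split => //; rewrite setTI probability_setT mul1e.
  + move=> C [mC EC]; split; first exact: measurableC.
    have -> : P (~` C `&` xi t @^-1` B) =
        (P (xi t @^-1` B) - P (C `&` xi t @^-1` B))%E.
      rewrite setIC -setDE [X in (_ - P X)%E]setIC.
      by apply: measureD => //; rewrite ltey_eq fin_num_measure.
    rewrite EC probability_setC//.
    have := fin_num_measure P _ mC; have := fin_num_measure P _ mxB.
    move=> /fineK <- /fineK <-.
    by rewrite -EFinM -!EFinB -EFinM mulrBl mul1r.
  + move=> F tF HF; have mF k : measurable (F k) := (HF k).1.
    split; first exact: bigcupT_measurable.
    have -> : P (\bigcup_k F k) = (\sum_(k <oo) P (F k))%E.
      by apply: measure_semi_bigcup => //; exact: bigcupT_measurable.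
    have mFB k : measurable (F k `&` xi t @^-1` B) by exact: measurableI.
    have -> : P ((\bigcup_k F k) `&` xi t @^-1` B) =
        (\sum_(k <oo) P (F k `&` xi t @^-1` B))%E.
      rewrite setI_bigcupl; apply: measure_semi_bigcup => //.
        exact: trivIset_setIr.
      exact: bigcupT_measurable.
    rewrite muleC -[X in (X * _)%E]fineK; last exact: fin_num_measure.
    rewrite -nneseriesZl; last by move=> k _; exact: measure_ge0.
    apply: eq_eseriesr => k _; rewrite (HF k).2 muleC fineK//.
    exact: fin_num_measure.
- move=> _ [C mC ->].
  split; first by apply: (@cylinder_measurable t); apply: sub_sigma_algebra; exists C.
  (* Adding the constraint [B] on coordinate [t] gives a cylinder over [t.+1] coordinates, to which
     mutual independence applies again. *)
  pose D j := if j == t then B else C j.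
  have mD j : measurable (D j) by rewrite /D; case: ifP.
  rewrite (xi_indep (iota_uniq 0 t) (fun j _ => mC j)).
  have -> : (\bigcap_(j in [set` iota 0 t]) (xi j @^-1` C j)) `&` xi t @^-1` B =
      \bigcap_(j in [set` iota 0 t.+1]) (xi j @^-1` D j).
    rewrite !set_iotaE; apply/seteqP; split => w /= => [[wC wB] j /= jt|wD].
      rewrite /D; case: eqP => [->//|/eqP jNt]; apply: wC => /=.
      by rewrite ltn_neqAle jNt -ltnS.
    split => [j /= jt|]; last by have := wD t (ltnSn t); rewrite /D eqxx.
    by have := wD j (ltnW jt); rewrite /D (ltn_eqF jt).
  rewrite (xi_indep (iota_uniq 0 t.+1) (fun j _ => mD j)).
  rewrite -[in iota 0 t.+1]addn1 iotaD add0n big_cat /= big_seq1.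
  rewrite {2}/D eqxx; congr (_ * _)%E; apply: eq_big_seq => j.
  by rewrite mem_iota add0n /D => /andP[_ jt]; rewrite (ltn_eqF jt).
Qed.

Lemma adapted_indep t f : adapted t f -> indep P f (xi t).
Proof.
move=> af A B mA mB; apply: history_indep => //.
by rewrite -[X in smallest _ _ X]setTI; exact: af.
Qed.

End history.

(** * One step of the recursion *)

Section measurability.
Context {d : measure_display} {T : measurableType d} {R : realType}.
Implicit Types f : T -> R.

Lemma measurable_huber s f : measurable_fun setT f ->
  measurable_fun setT (fun w => huber s (f w)).
Proof.
move=> mf; apply: measurable_funB; first exact: measurable_funX.
apply: measurable_funX; apply: measurable_maxr => //.
by apply: measurable_funB => //; exact: measurableT_comp.
Qed.

Lemma measurable_trunc_sqr M f : measurable_fun setT f ->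
  measurable_fun setT (fun w => trunc_sqr M (f w)).
Proof.
move=> mf; apply: measurable_fun_ifT => //.
  by apply: measurable_fun_ler => //; exact: measurableT_comp.
exact: measurable_funX.
Qed.

End measurability.

(** * Truncated second moments of the noise *)

Section truncated_moment.
Context {d : measure_display} {T : measurableType d} {R : realType}.
Variable P : probability T R.

Lemma trunc_sqr_ge0 (M q : R) : 0 <= trunc_sqr M q.
Proof. by rewrite /trunc_sqr; case: ifP => // _; exact: sqr_ge0. Qed.

Lemma trunc_sqr_le (M q : R) : trunc_sqr M q <= q ^+ 2.
Proof. by rewrite /trunc_sqr; case: ifP => // _; exact: sqr_ge0. Qed.

(** By monotone convergence the moments truncated at integer levels increase to [S]; if all were
    below [c], so would be the limit, up to equality. *)
Lemma truncated_moment (X : {RV P >-> R}) (S c : R) :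
  (\int[P]_w (X w ^+ 2)%:E = S%:E)%E -> c < S ->
  exists2 M : R, 0 <= M & c <= \int[P]_w trunc_sqr M (X w).
Proof.
move=> ES cS.
have mtr M : measurable_fun setT (fun w => trunc_sqr M (X w)).
  exact: measurable_trunc_sqr.
have : (\int[P]_w (trunc_sqr n%:R (X w))%:E @[n --> \oo] -->
    \int[P]_w (X w ^+ 2)%:E)%E.
  have -> : (\int[P]_w (X w ^+ 2)%:E =
      \int[P]_w limn (fun n => (trunc_sqr n%:R (X w))%:E))%E.
    apply: eq_integral => w _; apply/esym/cvg_lim => //.
    apply: cvg_near_cst; near=> n; congr EFin; rewrite /trunc_sqr.
    rewrite ifT//; near: n; exact: nbhs_infty_ger.
  apply: cvg_monotone_convergence => //.
  - by move=> n; exact/measurable_EFinP.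
  - by move=> n w _; rewrite lee_fin trunc_sqr_ge0.
  - move=> w _ m n mn; rewrite lee_fin /trunc_sqr.
    case: ifPn => [Xm|_]; last by case: ifP => // _; exact: sqr_ge0.
    by rewrite ifT//; apply: le_trans Xm _; rewrite ler_nat.
rewrite ES => cvgS; apply: contrapT => small.
have : (S%:E <= c%:E)%E; last by rewrite lee_fin leNgt cS.
apply: cvge_to_le cvgS _; apply: nearW => n.
have tri : P.-integrable [set: T] (EFin \o (fun w => trunc_sqr n%:R (X w))).
  apply: (integ_dom (f := fun w => X w ^+ 2)) => //.
    apply/integrableP; split; first exact/measurable_EFinP/measurable_funX.
    by under eq_integral do rewrite /= ger0_norm ?sqr_ge0//; rewrite ES ltry.
  by move=> w; rewrite ger0_norm ?trunc_sqr_ge0 ?trunc_sqr_le.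
rewrite -EFin_Rintegral// lee_fin leNgt; apply/negP => /ltW cn.
by apply: small; exists n%:R.
Unshelve. all: by end_near. Qed.

(** Carries a truncation level found for one noise variable over to all times. *)
Lemma identically_distributed_Rintegral (xi : nat -> {RV P >-> R}) (f : R -> R) i j :
  identically_distributed xi -> measurable_fun setT f -> (forall r, 0 <= f r) ->
  \int[P]_w f (xi i w) = \int[P]_w f (xi j w).
Proof.
move=> id mf f0; rewrite /Rintegral; congr fine.
have E k : (\int[P]_w (f (xi k w))%:E =
    \int[distribution P (xi k)]_r (f r)%:E)%E.
  by rewrite ge0_integral_distribution//; exact/measurable_EFinP.
rewrite (E i) (E j); apply: eq_measure_integral => A mA _; exact: id.
Qed.

End truncated_moment.

Section one_step.
Context {d : measure_display} {T : measurableType d} {R : realType}.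
Variable P : probability T R.
Local Notation integ f := (P.-integrable [set: T] (EFin \o f)).

Variables (x z m X : T -> R) (a b S : R).
Hypotheses (sx : sqint P x) (sz : sqint P z) (sX : sqint P X).
Hypotheses (mm : measurable_fun setT m) (mX : indep P m X).
Hypotheses (EX : \int[P]_w X w = 0) (EX2 : \int[P]_w (X w ^+ 2) = S).
Hypotheses (a0 : 0 < a) (a1 : a <= 1 / 12) (b0 : 0 < b) (ba : 200 * b <= a).
Hypothesis z0 : forall w, 0 <= z w.
Hypothesis mE : forall w, `|m w - (1 - a) * x w| <= b * (z w + `|x w|).

(** With [e] the deviation of [m] from [(1 - a) * x], convexity gives
    [m ^+ 2 <= (1 - a) * x ^+ 2 + e ^+ 2 / a]. The last term has coefficient [2 * b ^+ 2 / a], which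
    is at most [b / 100] because [200 * b <= a]. *)
Lemma drift_sqr_le w :
  m w ^+ 2 <= (1 - a) * x w ^+ 2 + b / 100 * (x w ^+ 2 + z w ^+ 2).
Proof.
set e := m w - (1 - a) * x w.
have e2 : e ^+ 2 <= b ^+ 2 * (2 * (x w ^+ 2 + z w ^+ 2)).
  apply: (@le_trans _ _ ((b * (z w + `|x w|)) ^+ 2)).
    rewrite -(real_normK (num_real e)) lerXn2r ?nnegrE//; last exact: mE.
    by rewrite mulr_ge0 ?addr_ge0// ltW.
  rewrite exprMn ler_wpM2l ?sqr_ge0// -(real_normK (num_real (x w))).
  by have := sqr_ge0 (z w - `|x w|); nra.
(* convexity of the square, for [m = (1 - a) x + a (e / a)] *)
have sq : 0 <= (1 - a) * (a * x w - e) ^+ 2.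
  by apply: mulr_ge0; [move: a1; lra|exact: sqr_ge0].
have n0 : 0 <= x w ^+ 2 + z w ^+ 2 by rewrite addr_ge0 ?sqr_ge0.
have bb : b ^+ 2 * (2 * (x w ^+ 2 + z w ^+ 2)) <=
    a * (b / 100) * (x w ^+ 2 + z w ^+ 2).
  rewrite mulrA ler_wpM2r//.
  by have := ler_wpM2l (ltW b0) ba; lra.
have -> : m w = (1 - a) * x w + e by rewrite addrC subrK.
by rewrite -(ler_pM2l a0); nra.
Qed.

Lemma sqint_drift : sqint P m.
Proof.
apply: (sqint_dom sx sz mm) => w.
have := mE w; have := z0 w => zw; rewrite (ger0_norm zw).
have := ler_normD (m w - (1 - a) * x w) ((1 - a) * x w).
rewrite subrK normrM (ger0_norm (_ : 0 <= 1 - a)); last by move: a1; lra.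
have := normr_ge0 (x w); set u := `|x w|; set v := `|m w| => u0.
have bz : b * z w <= z w by rewrite ler_piMl//; move: a1 ba; lra.
have bu : b * u <= a * u by rewrite ler_wpM2r//; move: ba b0; lra.
by nra.
Qed.

Lemma sqint_noisy (c : R) : sqint P (fun w => m w - c * X w).
Proof.
have [mX' _] := sX.
have scX : sqint P (fun w => c * X w).
  split; first exact: measurable_funM.
  have -> : (fun w => (c * X w) ^+ 2) = (fun w => c ^+ 2 * X w ^+ 2).
    by apply/funext => w; rewrite exprMn.
  by apply: integZ; exact: sX.2.
apply: (sqint_dom sqint_drift scX); last by move=> w; exact: ler_normB.
by apply: measurable_funB => //; exact: scX.1.
Qed.

Lemma Rintegral_noisy_fixed (r : R) :
  integ (fun w => (r - a * X w) ^+ 2) /\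
  \int[P]_w ((r - a * X w) ^+ 2) = r ^+ 2 + a ^+ 2 * S.
Proof.
have -> : (fun w => (r - a * X w) ^+ 2) =
    (fun w => r ^+ 2 + (- (2 * r * a) * X w + a ^+ 2 * X w ^+ 2)).
  by apply/funext => w; ring.
have i0 := integ_cst P (r ^+ 2).
have i1 := integZ (- (2 * r * a)) (sqint_integ sX).
have i2 := integZ (a ^+ 2) sX.2.
split; first by apply: integD => //; exact: integD.
rewrite RintegralD//; last exact: integD.
rewrite RintegralD// Rintegral_probability_cst !RintegralZl//.
- by rewrite EX EX2 mulr0 add0r.
- exact: sqint_integ.
- exact: sX.2.
Qed.

(** For a frozen drift the centred noise kills the cross term; independence then allows averaging
    over the drift. *)
Lemma Rintegral_noisy_sqr :
  \int[P]_w ((m w - a * X w) ^+ 2) = \int[P]_w (m w ^+ 2) + a ^+ 2 * S.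
Proof.
pose k (p : R * R) := (p.1 - a * p.2) ^+ 2.
have mk : measurable_fun setT k.
  apply: measurable_funX; apply: measurable_funB => //.
  exact: measurable_funM.
have [_ ->] := indep_iterated mm sX.1 mX mk (fun p => sqr_ge0 _)
  (sqint_noisy a).2 (fun r => (Rintegral_noisy_fixed r).1).
under eq_Rintegral do rewrite (Rintegral_noisy_fixed _).2.
rewrite RintegralD//; [|exact: sqint_drift.2|exact: integ_cst].
by rewrite Rintegral_probability_cst.
Qed.

Lemma Rintegral_drift_sqr_le : \int[P]_w (m w ^+ 2) <=
  (1 - a) * \int[P]_w (x w ^+ 2)
    + b / 100 * (\int[P]_w (x w ^+ 2) + \int[P]_w (z w ^+ 2)).
Proof.
have ix := sx.2; have iz := sz.2.
rewrite -RintegralD// -!RintegralZl//; last exact: integD.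
rewrite -RintegralD//; [|exact: integZ|by apply: integZ; exact: integD].
apply: le_Rintegral => //; first exact: sqint_drift.2.
  by apply: integD; apply: integZ => //; exact: integD.
by move=> w _; exact: drift_sqr_le.
Qed.

Lemma sqint_huber s f : 0 < s -> sqint P f -> integ (fun w => huber s (f w)).
Proof.
move=> s0 sf; apply: integ_dom sf.2 _; first exact: measurable_huber sf.1.
by move=> w; rewrite ger0_norm ?huber_ge0 ?huber_le_sqr.
Qed.

(** The contraction costs a factor [(1 - a) ^+ 2 >= 1 - 2 * a] by [huber_scale]. The deviation is
    charged at slope [2 * s], and the products of [s] with [z] and [|x|] are split into squares. *)
Lemma huber_drift_ge s w : 0 < s ->
  (1 - 2 * a) * huber s (x w) - b * (2 * s ^+ 2 + x w ^+ 2 + z w ^+ 2)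
  <= huber s (m w).
Proof.
move=> s0; have lip := huber_lipschitz ((1 - a) * x w) (m w) s0.
rewrite distrC in lip.
have scl : (1 - 2 * a) * huber s (x w) <= huber s ((1 - a) * x w).
  apply: le_trans (huber_scale (x w) s0 (_ : 0 <= 1 - a <= 1)).
    by rewrite ler_wpM2r ?huber_ge0//; have := sqr_ge0 a; lra.
  by apply/andP; split; move: a0 a1; lra.
have dev : 2 * s * `|m w - (1 - a) * x w|
    <= b * (2 * s ^+ 2 + x w ^+ 2 + z w ^+ 2).
  apply: (@le_trans _ _ (2 * s * (b * (z w + `|x w|)))).
    by rewrite ler_wpM2l//; lra.
  rewrite (mulrCA _ b) ler_wpM2l ?(ltW b0)// -(real_normK (num_real (x w))).
  by have := sqr_ge0 (s - z w); have := sqr_ge0 (s - `|x w|); lra.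
by lra.
Qed.

(** The first-order term of [huber_expand] vanishes for centred noise, and the truncated second
    moment remains as the gain. *)
Lemma Rintegral_huber_fixed_ge (s M r : R) : 0 < s -> a * M <= s / 2 ->
  huber s r + a ^+ 2 * (\int[P]_w trunc_sqr M (X w)) * (1 - 4 * r ^+ 2 / s ^+ 2)
  <= \int[P]_w huber s (r - a * X w).
Proof.
move=> s0 aM; set g := 1 - _.
have itr : integ (fun w => trunc_sqr M (X w)).
  apply: integ_dom sX.2 _; first exact: measurable_trunc_sqr sX.1.
  by move=> w; rewrite ger0_norm ?trunc_sqr_ge0 ?trunc_sqr_le.
have iX := sqint_integ sX.
have i1 := integZ (- (2 * clip s r * a)) iX.
have i2 := integZ (a ^+ 2 * g) itr.
have -> : huber s r + a ^+ 2 * (\int[P]_w trunc_sqr M (X w)) * g =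
  \int[P]_w (huber s r + (- (2 * clip s r * a) * X w
     + a ^+ 2 * g * trunc_sqr M (X w))).
  have ic := integ_cst P (huber s r); have i3 := integD i1 i2.
  rewrite (RintegralD measurableT ic i3) (RintegralD measurableT i1 i2).
  rewrite Rintegral_probability_cst !RintegralZl// EX.
  by ring.
apply: le_Rintegral => //.
- by apply: integD; [exact: integ_cst|exact: integD].
- apply: integ_dom (Rintegral_noisy_fixed r).1 _.
    apply: measurable_huber; apply: measurable_funB => //.
    by apply: measurable_funM => //; exact: sX.1.
  by move=> w; rewrite ger0_norm ?huber_ge0 ?huber_le_sqr.
- move=> w _; have := huber_expand r (X w) s0 (ltW a0) aM; rewrite -/g; lra.
Qed.

(** The bound on the drift keeps the mean of [1 - 4 * m ^+ 2 / s ^+ 2] at least 1/2; together with a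
    truncated moment of at least [S / 2] this yields the gain [a ^+ 2 * S / 4]. *)
Lemma Rintegral_huber_step (s M : R) : 0 < s -> 0 <= S -> a * M <= s / 2 ->
  S / 2 <= \int[P]_w trunc_sqr M (X w) ->
  8 * \int[P]_w (m w ^+ 2) <= s ^+ 2 ->
  (1 - 2 * a) * \int[P]_w huber s (x w) + a ^+ 2 * S / 4
    - b * (2 * s ^+ 2 + \int[P]_w (x w ^+ 2) + \int[P]_w (z w ^+ 2))
  <= \int[P]_w huber s (m w - a * X w).
Proof.
move=> s0 S0 aM; set tau := \int[P]_w trunc_sqr M (X w) => Stau ms.
have s20 : 0 < s ^+ 2 by rewrite exprn_gt0.
pose k (p : R * R) := huber s (p.1 - a * p.2).
have mk : measurable_fun setT k.
  apply: measurable_huber; apply: measurable_funB => //.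
  exact: measurable_funM.
have ikr r : integ (fun w => k (r, X w)).
  apply: integ_dom (Rintegral_noisy_fixed r).1 _.
    apply: measurable_huber; apply: measurable_funB => //.
    by apply: measurable_funM => //; exact: sX.1.
  by move=> w; rewrite ger0_norm ?huber_ge0 ?huber_le_sqr.
have [ii ->] := indep_iterated mm sX.1 mX mk (fun p => huber_ge0 _ s0)
  (sqint_huber s0 (sqint_noisy a)) ikr.
have im := sqint_huber s0 sqint_drift.
have ix := sqint_huber s0 sx.
have im2 := integZ (- (4 * a ^+ 2 * tau / s ^+ 2)) sqint_drift.2.
have ix2 := sx.2; have iz2 := sz.2.
have low : \int[P]_w huber s (m w)
    + (- (4 * a ^+ 2 * tau / s ^+ 2) * \int[P]_w (m w ^+ 2) + a ^+ 2 * tau)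
    <= \int[P]_w \int[P]_v k (m w, X v).
  rewrite -RintegralZl//; last exact: sqint_drift.2.
  rewrite -[X in _ + (_ + X) <= _](Rintegral_probability_cst P (a ^+ 2 * tau)).
  have ic := integ_cst P (a ^+ 2 * tau).
  rewrite -!RintegralD//; last exact: integD.
  apply: le_Rintegral => //; first by apply: integD => //; exact: integD.
  move=> w _; have := Rintegral_huber_fixed_ge (m w) s0 aM; rewrite -/tau.
  by congr (_ <= _); ring.
have drift : (1 - 2 * a) * \int[P]_w huber s (x w)
    - b * (2 * s ^+ 2 + \int[P]_w (x w ^+ 2) + \int[P]_w (z w ^+ 2))
    <= \int[P]_w huber s (m w).
  have ic := integ_cst P (- (2 * b * s ^+ 2)).
  have i1 := integZ (1 - 2 * a) ix.
  have i2 := integZ (- b) ix2; have i3 := integZ (- b) iz2.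
  have i4 := integD i2 i3; have i5 := integD ic i4.
  apply: (@le_trans _ _ (\int[P]_w ((1 - 2 * a) * huber s (x w) +
      (- (2 * b * s ^+ 2) + (- b * x w ^+ 2 + - b * z w ^+ 2))))).
    rewrite (RintegralD measurableT i1 i5) (RintegralD measurableT ic i4).
    rewrite (RintegralD measurableT i2 i3) Rintegral_probability_cst.
    by rewrite !RintegralZl//; lra.
  apply: le_Rintegral => //; first exact: integD.
  by move=> w _; have := huber_drift_ge w s0; lra.
have : 4 * a ^+ 2 * tau / s ^+ 2 * \int[P]_w (m w ^+ 2) <= a ^+ 2 * tau / 2.
  have -> : 4 * a ^+ 2 * tau / s ^+ 2 * \int[P]_w (m w ^+ 2) =
    a ^+ 2 * tau / 2 * (8 * \int[P]_w (m w ^+ 2) / s ^+ 2) by field; lra.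
  rewrite -[leRHS]mulr1 ler_wpM2l//.
    have tau0 : 0 <= tau by apply: le_trans Stau; exact: divr_ge0.
    by apply: divr_ge0 => //; apply: mulr_ge0 => //; exact: sqr_ge0.
  by rewrite ler_pdivrMr// mul1r.
have : a ^+ 2 * (S / 2) <= a ^+ 2 * tau by rewrite ler_wpM2l ?sqr_ge0.
by lra.
Qed.

End one_step.

(** * Lower bounds along the recursion *)

Lemma sqint_norm {d : measure_display} {T : measurableType d} {R : realType}
  (P : probability T R) (f : T -> R) : sqint P f -> sqint P (fun w => `|f w|).
Proof.
move=> sf; apply: (sqint_dom sf (sqint_cst P 0)).
  by apply: measurableT_comp => //; exact: sf.1.
by move=> w; rewrite normr_id normr0 addr0.
Qed.

(** * The abstract system: fast error [x], slow modulus [z], drift [m], noise [X] *)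

Section two_time_scale.
Context {d : measure_display} {T : measurableType d} {R : realType}.
Variable P : probability T R.
Local Notation integ f := (P.-integrable [set: T] (EFin \o f)).

Variables (a b : nat -> R) (x z m X : nat -> T -> R) (S M : R).
Hypotheses (a0 : forall t, 0 < a t) (b0 : forall t, 0 < b t).
Hypotheses (ba : forall t, 200 * b t <= a t) (a1 : forall t, a t <= 1 / 12).
Hypothesis a_dec : forall t, a t.+1 <= a t.
Hypothesis a_slow_a : forall t, a t * (1 - a t / 16) <= a t.+1.
Hypothesis a_slow_b : forall t, a t * (1 - b t / 16) <= a t.+1.
Hypothesis ba_cvg : (fun t => b t / a t) @ \oo --> (0 : R).
Hypotheses (S0 : 0 < S) (M0 : 0 <= M).
Hypothesis sX : forall t, sqint P (X t).
Hypothesis EX : forall t, \int[P]_w X t w = 0.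
Hypothesis EX2 : forall t, \int[P]_w (X t w ^+ 2) = S.
Hypothesis trM : forall t, S / 2 <= \int[P]_w trunc_sqr M (X t w).
Hypothesis mm : forall t, measurable_fun setT (m t).
Hypothesis mX : forall t, indep P (m t) (X t).
Hypotheses (sx0 : sqint P (x 0%N)) (sz0 : sqint P (z 0%N)).
Hypothesis Ez0 : 0 < \int[P]_w z 0%N w.
Hypothesis z0 : forall t w, 0 <= z t w.
Hypothesis mE : forall t w,
  `|m t w - (1 - a t) * x t w| <= b t * (z t w + `|x t w|).
Hypothesis xE : forall t, x t.+1 = (fun w => m t w - a t * X t w).
Hypothesis zE : forall t, z t.+1 = (fun w => (1 - b t) * z t w + b t * `|x t w|).

Let b1 t : b t <= 1. Proof. by have := ba t; have := a1 t; have := b0 t; lra. Qed.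

Lemma sqint_iterates t : sqint P (x t) /\ sqint P (z t).
Proof.
elim: t => [//|t [sx sz]]; split.
  rewrite xE; exact: (sqint_noisy sx sz (sX t) (@mm t) (a1 t) (b0 t)
    (ba t) (@z0 t) (@mE t)).
apply: (sqint_dom sz sx).
  rewrite zE; apply: measurable_funD; apply: measurable_funM => //.
    exact: sz.1.
  by apply: measurableT_comp => //; exact: sx.1.
move=> w; rewrite zE ger0_norm.
  rewrite (ger0_norm (z0 t w)); have := z0 t w; have := normr_ge0 (x t w).
  by have := b0 t; have := b1 t; nra.
by apply: addr_ge0; apply: mulr_ge0 => //; [rewrite subr_ge0|exact: ltW].
Qed.

Let sx t := (sqint_iterates t).1.
Let sz t := (sqint_iterates t).2.

Let EX2x t : \int[P]_w (x t.+1 w ^+ 2) = \int[P]_w (m t w ^+ 2) + a t ^+ 2 * S.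
Proof.
rewrite xE; exact: (Rintegral_noisy_sqr (sx t) (sz t) (sX t) (@mm t) (@mX t)
  (EX t) (EX2 t) (a1 t) (b0 t) (ba t) (@z0 t) (@mE t)).
Qed.

Let Ez2 t : \int[P]_w (z t.+1 w ^+ 2) <=
  (1 - b t) * \int[P]_w (z t w ^+ 2) + b t * \int[P]_w (x t w ^+ 2).
Proof.
have ix := (sx t).2; have iz := (sz t).2.
have i1 := integZ (1 - b t) iz; have i2 := integZ (b t) ix.
rewrite -!RintegralZl// -(RintegralD measurableT i1 i2).
apply: le_Rintegral => //; [exact: (sz t.+1).2|exact: integD|move=> w _].
rewrite zE -(real_normK (num_real (x t w))).
(* The gap in Jensen's inequality for the square with weights [1 - b t] and [b t]. *)
have : 0 <= b t * (1 - b t) * (z t w - `|x t w|) ^+ 2.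
  apply: mulr_ge0 (sqr_ge0 _).
  by apply: mulr_ge0; [exact: ltW|rewrite subr_ge0].
by lra.
Qed.

Let Ez t : \int[P]_w z t.+1 w =
  (1 - b t) * \int[P]_w z t w + b t * \int[P]_w `|x t w|.
Proof.
have iz := sqint_integ (sz t).
have ix : integ (fun w => `|x t w|) by apply: sqint_integ; exact: sqint_norm.
have i1 := integZ (1 - b t) iz; have i2 := integZ (b t) ix.
by rewrite zE (RintegralD measurableT i1 i2) !RintegralZl.
Qed.

Lemma second_moments_le : exists2 D : R, 0 <= D & forall t,
  \int[P]_w (x t w ^+ 2) <= D * a t /\ \int[P]_w (z t w ^+ 2) <= 2 * D * a t.
Proof.
pose X0 := \int[P]_w (x 0%N w ^+ 2); pose Z0 := \int[P]_w (z 0%N w ^+ 2).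
have X00 : 0 <= X0 by apply: Rintegral_ge0 => w _; exact: sqr_ge0.
have Z00 : 0 <= Z0 by apply: Rintegral_ge0 => w _; exact: sqr_ge0.
(* The summands serve in turn [2 * S <= D] and the two bounds at time 0. *)
pose D := 2 * S + X0 / a 0%N + Z0 / a 0%N.
have q1 : 0 <= X0 / a 0%N by rewrite divr_ge0// ltW.
have q2 : 0 <= Z0 / a 0%N by rewrite divr_ge0// ltW.
have D0 : 0 <= D by move: S0; rewrite /D; lra.
exists D => //; apply: (upper_recursion (S := S) (X := fun t => \int[P]_w (x t w ^+ 2))
  a0 b0 ba a1 a_slow_a a_slow_b _ Ez2 D0).
- move=> t; rewrite EX2x lerD2r.
  exact: (Rintegral_drift_sqr_le (sx t) (sz t) (@mm t) (a0 t) (a1 t) (b0 t)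
    (ba t) (@z0 t) (@mE t)).
- by rewrite /D; lra.
- by rewrite -ler_pdivrMr// -/X0; move: S0; rewrite /D; lra.
- by rewrite -ler_pdivrMr// -/Z0; move: S0; rewrite /D; lra.
Qed.

(** The mean [J t] of the Huber function eventually obeys a recursion in which the loss
    [2 * a t * J t] and the noise gain [a t ^+ 2 * S / 8] balance when [J t] is of order [a t]; the
    shrinking radius contributes only the factor [a t.+1 / a t]. Dividing by the slope [2 * s t]
    leaves the order of [Num.sqrt (a t)]. *)
Lemma first_moment_ge : exists2 c : R, 0 < c & exists t0, forall t, (t0 <= t)%N ->
  c * Num.sqrt (a t) <= \int[P]_w `|x t w|.
Proof.
have [D D0 moms] := second_moments_le.
(* The term [2 * M] gives [a t * M <= s t / 2], the term [8 * D] gives the drift bound [ms], and 1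
   ensures [K <= K ^+ 2]. *)
pose K := 2 * M + 8 * D + 1; have K1 : 1 <= K by move: M0; rewrite /K; lra.
have K0 : 0 < K by lra.
have KD : 8 * D <= K ^+ 2.
  by apply: (@le_trans _ _ K); [move: M0; rewrite /K; lra|rewrite expr2 ler_peMl//; lra].
pose r t := Num.sqrt (a t).
have r0 t : 0 < r t by rewrite sqrtr_gt0.
have r2 t : r t ^+ 2 = a t by rewrite sqr_sqrtr// ltW.
have r1 t : r t <= 1.
  by rewrite -(@expr_le1 _ 2) ?(ltW (r0 t))// r2; have := a1 t; lra.
pose s t := K * r t.
have s0 t : 0 < s t by rewrite mulr_gt0.
have s2 t : s t ^+ 2 = K ^+ 2 * a t by rewrite exprMn r2.
pose J t := \int[P]_w huber (s t) (x t w).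
have J0 t : 0 <= J t by apply: Rintegral_ge0 => w _; exact: huber_ge0.
(* From [t0] on, the coupling consumes at most half of the gain [a t ^+ 2 * S / 4]. *)
have [t0 bsmall] : exists t0, forall t, (t0 <= t)%N ->
    b t * (2 * K ^+ 2 + 3 * D) <= a t * S / 8.
  have C0 : 0 < 2 * K ^+ 2 + 3 * D.
    by have : 0 < K ^+ 2; [rewrite exprn_gt0|lra].
  pose e := S / 8 / (2 * K ^+ 2 + 3 * D).
  have e0 : 0 < e by rewrite !divr_gt0.
  have /cvgrPdist_lt/(_ _ e0)[t0 _ small] := ba_cvg.
  exists t0 => t t0t; have := small _ t0t.
  rewrite /= sub0r normrN gtr0_norm ?divr_gt0// /e ltr_pdivlMr//.
  rewrite mulrAC ltr_pdivrMr// => /ltW; lra.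
have step t : (t0 <= t)%N ->
    a t.+1 / a t * ((1 - 2 * a t) * J t + a t ^+ 2 * S / 8) <= J t.+1.
  move=> t0t.
  have [Xt Zt] := moms t; have [Xt1 _] := moms t.+1.
  have aM : a t * M <= s t / 2.
    have h1 : 0 <= M * (r t * (1 - r t)).
      by rewrite !mulr_ge0 ?subr_ge0 ?(ltW (r0 t)).
    have h2 : 0 <= r t * (K - 2 * M).
      by rewrite mulr_ge0 ?(ltW (r0 t))// /K; lra.
    by rewrite -r2 /s; lra.
  (* The mean square of [m t] is that of [x t.+1] minus the noise contribution, so the bound at time
     [t.+1] covers it. *)
  have ms : 8 * \int[P]_w (m t w ^+ 2) <= s t ^+ 2.
    rewrite s2; apply: (@le_trans _ _ (8 * D * a t)); last first.
      by rewrite ler_wpM2r// ltW.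
    have := EX2x t; have : D * a t.+1 <= D * a t by rewrite ler_wpM2l.
    have : 0 <= a t ^+ 2 * S by rewrite mulr_ge0 ?sqr_ge0// ltW.
    by lra.
  have := Rintegral_huber_step (sx t) (sz t) (sX t) (@mm t) (@mX t)
    (EX t) (EX2 t) (a0 t) (a1 t) (b0 t) (ba t) (@z0 t) (@mE t)
    (s0 t) (ltW S0) aM (trM t) ms.
  rewrite [in X in _ <= X](_ : (fun w => _) = fun w => huber (s t) (x t.+1 w));
    last by rewrite xE.
  rewrite -/(J t) s2 => hub.
  have bt : b t * (2 * (K ^+ 2 * a t) + \int[P]_w (x t w ^+ 2)
      + \int[P]_w (z t w ^+ 2)) <= a t ^+ 2 * S / 8.
    apply: (@le_trans _ _ (b t * ((2 * K ^+ 2 + 3 * D) * a t))).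
      by rewrite ler_wpM2l ?(ltW (b0 t))//; lra.
    have := ler_wpM2r (ltW (a0 t)) (bsmall t t0t); lra.
  (* So far the radius is still [s t]; [huber_radius] now replaces it by [s t.+1]. *)
  apply: (@le_trans _ _ (a t.+1 / a t * \int[P]_w huber (s t) (x t.+1 w))).
    by rewrite ler_wpM2l ?divr_ge0 ?(ltW (a0 _))//; lra.
  have ss : s t.+1 <= s t.
    by rewrite /s ler_wpM2l ?(ltW K0)// ler_wsqrtr.
  have iH : integ (fun w => huber (s t) (x t.+1 w)) by exact: sqint_huber.
  rewrite /J -RintegralZl//; apply: le_Rintegral => //.
    exact: integZ.
    exact: sqint_huber.
  move=> w _; have := huber_radius (x t.+1 w) (s0 t.+1) ss.
  rewrite !s2 -!mulrA ler_pM2l ?exprn_gt0// => radius.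
  by rewrite mulrA mulrAC ler_pdivrMr// [leRHS]mulrC -(ler_pM2l K0).
(* The start is [t0.+1] because one noise step makes [J] positive even if [J t0] vanishes. *)
have [c c0 Jc] : exists2 c : R, 0 < c & forall t, (t0.+1 <= t)%N ->
    c * a t <= J t.
  (* For [c <= S / 16] the loss [2 * a t * (c * a t)] does not exceed the gain
     [a t ^+ 2 * S / 8]. *)
  apply: (lower_recursion (k := S / 16)) => //; first by rewrite divr_gt0.
    apply: lt_le_trans (step t0 (leqnn _)).
    apply: mulr_gt0; first by rewrite divr_gt0.
    apply: ltr_wpDl; last by rewrite !mulr_gt0 ?exprn_gt0.
    by rewrite mulr_ge0//; have := a1 t0; lra.
  move=> t t0t c c0 cS IH; apply: le_trans (step t (ltnW t0t)).
  have -> : c * a t.+1 = a t.+1 / a t * (c * a t).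
    by rewrite [RHS]mulrCA divfK ?gt_eqF.
  rewrite ler_wpM2l ?divr_ge0 ?(ltW (a0 _))//.
  have h1 : (1 - 2 * a t) * (c * a t) <= (1 - 2 * a t) * J t.
    by rewrite ler_wpM2l//; have := a1 t; lra.
  have h2 : a t ^+ 2 * c <= a t ^+ 2 * (S / 16) by rewrite ler_wpM2l ?sqr_ge0.
  by lra.
exists (c / (2 * K)); first by rewrite divr_gt0// mulr_gt0.
exists t0.+1 => t t0t.
have JX : J t <= 2 * s t * \int[P]_w `|x t w|.
  have iH : integ (fun w => huber (s t) (x t w)) by exact: sqint_huber.
  have ix : integ (fun w => `|x t w|).
    by apply: sqint_integ; exact: sqint_norm.
  rewrite -RintegralZl//; apply: le_Rintegral => //; first exact: integZ.
  by move=> w _; exact: huber_le_norm.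
have h := le_trans (Jc t t0t) JX; rewrite -r2 /s in h; rewrite -/(r t).
have r20 : 0 < 2 * (K * r t) by rewrite !mulr_gt0.
rewrite -(ler_pM2l r20); apply: le_trans h.
have -> : 2 * (K * r t) * (c / (2 * K) * r t) = c * r t ^+ 2 by field; lra.
exact: lexx.
Qed.

(** Each new mean of [z] is a convex combination of the old one and the mean of [|x|]. A common
    lower bound [c * Num.sqrt (a t)] therefore survives, as [a] is non-increasing. *)
Lemma slow_first_moment_ge : exists2 c : R, 0 < c & exists t0,
  forall t, (t0 <= t)%N -> c * Num.sqrt (a t) <= \int[P]_w z t w.
Proof.
have [k k0 [t0 xk]] := first_moment_ge.
have r0 t : 0 < Num.sqrt (a t) by rewrite sqrtr_gt0.
have r_dec t : Num.sqrt (a t.+1) <= Num.sqrt (a t) by rewrite ler_wsqrtr.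
have Ez_gt0 t : 0 < \int[P]_w z t w.
  elim: t => // t IH; rewrite Ez ltr_pwDl//.
    by rewrite mulr_gt0// subr_gt0; have := ba t; have := a1 t; lra.
  by rewrite mulr_ge0 ?(ltW (b0 t))//; apply: Rintegral_ge0.
have [c c0 zc] : exists2 c : R, 0 < c & forall t, (t0 <= t)%N ->
    c * Num.sqrt (a t) <= \int[P]_w z t w.
  apply: (lower_recursion (k := k)) => // t t0t c c0 ck IH.
  rewrite Ez; apply: (@le_trans _ _ (c * Num.sqrt (a t))).
    by rewrite ler_wpM2l// ltW.
  have h1 : (1 - b t) * (c * Num.sqrt (a t)) <= (1 - b t) * \int[P]_w z t w.
    by rewrite ler_wpM2l// subr_ge0.
  have h2 : b t * (c * Num.sqrt (a t)) <= b t * \int[P]_w `|x t w|.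
    rewrite ler_wpM2l ?(ltW (b0 t))//; apply: le_trans (xk t t0t).
    by rewrite ler_wpM2r ?(ltW (r0 t)).
  by lra.
by exists c => //; exists t0.
Qed.

Lemma second_moments_ge :
  is_Omega (fun t => \int[P]_w (x t w ^+ 2)) a /\
  is_Omega (fun t => \int[P]_w (z t w ^+ 2)) a.
Proof.
have square (c : R) t f : 0 < c -> sqint P f ->
    c * Num.sqrt (a t) <= \int[P]_w f w -> c ^+ 2 * a t <= \int[P]_w (f w ^+ 2).
  move=> c0 sf cf; apply: le_trans (sqr_Rintegral_le sf).
  rewrite -[a t]sqr_sqrtr ?(ltW (a0 t))// -exprMn lerXn2r ?nnegrE//.
    by rewrite mulr_ge0 ?sqrtr_ge0// ltW.
  by apply: le_trans cf; rewrite mulr_ge0 ?sqrtr_ge0// ltW.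
split.
- have [c c0 [t0 xc]] := first_moment_ge.
  exists (c ^+ 2); first exact: exprn_gt0.
  exists t0 => t t0t; have := square c t _ c0 (sqint_norm (sx t)) (xc t t0t).
  by under eq_Rintegral do rewrite real_normK ?num_real//.
- have [c c0 [t0 zc]] := slow_first_moment_ge.
  exists (c ^+ 2); first exact: exprn_gt0.
  by exists t0 => t t0t; exact: square (zc t t0t).
Qed.

End two_time_scale.

(** The given ratio is controlled by the step size [c1] at the later time. It is relaxed to the
    earlier [c0], and [(1 + c0 / 16) * (1 - c0 / 16) <= 1] inverts the bound. *)
Lemma slow_decay {R : realType} (a0 a1 c0 c1 : R) : 0 < a1 -> a1 <= a0 ->
  0 < c1 -> c1 <= c0 -> c0 <= 1 -> a0 / a1 <= 1 + c1 / 16 ->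
  a0 * (1 - c0 / 16) <= a1.
Proof.
move=> a10 a01 c10 c01 c01'; rewrite ler_pdivrMr// => h.
apply: (@le_trans _ _ ((1 + c1 / 16) * a1 * (1 - c0 / 16))).
  by rewrite ler_wpM2r//; lra.
apply: (@le_trans _ _ ((1 + c0 / 16) * a1 * (1 - c0 / 16))).
  by rewrite ler_wpM2r//; [lra|rewrite ler_wpM2r//; lra].
have : 0 <= a1 * (c0 / 16) ^+ 2 by rewrite mulr_ge0 ?sqr_ge0// ltW.
by lra.
Qed.

Theorem proposition3p1 (R : realType) (d : measure_display)
    (T : measurableType d) (P : probability T R)
    (xi psi : nat -> {RV P >-> R}) (Sigma1 : R)
    (alpha beta : nat -> R) (x0 y0 : R) (x y : nat -> T -> R)
    (* the iteration *)
    (hx0 : forall w, x 0%N w = x0)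
    (hy0 : forall w, y 0%N w = y0)
    (hx : forall t w,
      x t.+1 w = x t w - alpha t * (F (x t w) (y t w) + xi t w))
    (hy : forall t w,
      y t.+1 w = y t w - beta t * (G (x t w) (y t w) + psi t w))
    (* (a) *)
    (hpsi : forall t w, psi t w = 0)
    (hxi_iid : iid xi)
    (hxi_mean : forall t, ('E_P[xi t] = 0)%E)
    (hxi_var : forall t, ('E_P[(fun w => (xi t w ^+ 2)%R)] = Sigma1%:E)%E)
    (hSigma1 : 0 < Sigma1)
    (* (b) *)
    (halpha_gt0 : forall t, 0 < alpha t)
    (hbeta_gt0 : forall t, 0 < beta t)
    (hratio_cvg : (fun t => beta t / alpha t) @ \oo --> (0 : R))
    (halpha : forall t, alpha t <= 1 / 12)
    (hbeta : forall t, beta t <= 1 / 14)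
    (hratio : forall t, beta t / alpha t <= 1 / 200)
    (hratio2 : forall t, beta t ^+ 2 / alpha t <= 1 / 200)
    (halpha_step : forall t, (1 <= t)%N ->
      1 <= alpha t.-1 / alpha t
        <= 1 + Num.min (alpha t / 16) (beta t / 16))
    (hbeta_step : forall t, (1 <= t)%N ->
      1 <= beta t.-1 / beta t <= 1 + beta t / 64)
    (hratio_mono : forall s t, (s <= t)%N ->
      beta t / alpha t <= beta s / alpha s)
    (hprod : is_O (fun t => \prod_(0 <= tau < t.+1) (1 - beta tau / 4))
                  (fun t => alpha t ^+ 2))
    (* (c) *)
    (hy0_neq : y0 != ystar) :
  is_Omega (fun t => mean_square P (fun w => x t w - H (y t w))) alpha /\
  is_Omega (fun t => mean_square P (fun w => y t w - ystar)) alpha.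
Proof.
have a0 := halpha_gt0; have b0 := hbeta_gt0.
have ba t : 200 * beta t <= alpha t.
  by have := hratio t; rewrite ler_pdivrMr//; lra.
have a_dec t : alpha t.+1 <= alpha t.
  by have /andP[+ _] := halpha_step t.+1 isT; rewrite /= ler_pdivlMr// mul1r.
have b_dec t : beta t.+1 <= beta t.
  by have /andP[+ _] := hbeta_step t.+1 isT; rewrite /= ler_pdivlMr// mul1r.
have a_slow t : alpha t * (1 - alpha t / 16) <= alpha t.+1 /\
    alpha t * (1 - beta t / 16) <= alpha t.+1.
  have /andP[_ /= ra] := halpha_step t.+1 isT.
  split.
    apply: (@slow_decay _ _ _ _ (alpha t.+1)) => //.
      by have := halpha t; lra.
    by apply: le_trans ra _; rewrite lerD2l ge_min lexx.
  apply: (@slow_decay _ _ _ _ (beta t.+1)) => //.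
    by have := hbeta t; lra.
  by apply: le_trans ra _; rewrite lerD2l ge_min lexx orbT.
have [hindep hid] := hxi_iid.
(* Multiplication by the initial sign turns [y] into [z], which stays positive and hence equals
   [|y|]. *)
pose s := Num.sg y0.
have y00 : y0 != 0 by exact: hy0_neq.
have ss : s * s = 1 by rewrite -expr2 sqr_sg y00.
pose z t w := s * y t w; pose e t w := x t w - y t w.
have sgy t w : 0 < z t w -> Num.sg (y t w) = s.
  move=> zt; have := gtr0_sg zt; rewrite sgrM sgr_id => h.
  by rewrite -[LHS]mul1r -ss -mulrA h mulr1.
have ySE t w : 0 < z t w ->
    y t.+1 w = y t w - beta t * (y t w - `|e t w| * s).
  by move=> zt; rewrite hy hpsi addr0 /G sgy// [- _ + _]addrC.
have zS t w : 0 < z t w ->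
    z t.+1 w = (1 - beta t) * z t w + beta t * `|e t w|.
  move=> zt; rewrite /z ySE// mulrBr mulrCA (mulrBr s) mulrCA ss mulr1.
  by ring.
(* The recursion [zS] needs the sign at time [t] only, so positivity propagates, as [beta t < 1]. *)
have z_gt0 t w : 0 < z t w.
  elim: t => [|t IH]; first by rewrite /z hy0 /s -normrEsg normr_gt0.
  rewrite zS//; apply: ltr_wpDr; first by rewrite mulr_ge0 ?(ltW (b0 t)).
  by rewrite mulr_gt0// subr_gt0; have := hbeta t; lra.
(* Everything in [x t.+1 - y t.+1] except the current noise. *)
pose m t w := (1 - alpha t) * e t w + beta t * (y t w - `|e t w| * s).
have eS t w : e t.+1 w = m t w - alpha t * xi t w.
  by rewrite /e ySE ?z_gt0// hx /F /m /e; ring.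
have dev t w : `|m t w - (1 - alpha t) * e t w| <= beta t * (z t w + `|e t w|).
  have -> : m t w - (1 - alpha t) * e t w = beta t * s * (z t w - `|e t w|).
    have yE : y t w = s * z t w by rewrite /z mulrA ss mul1r.
    by rewrite /m yE; ring.
  rewrite !normrM (gtr0_norm (b0 t)).
  have -> : `|s| = 1 by rewrite /s normr_sg y00.
  rewrite mulr1 ler_wpM2l ?(ltW (b0 t))//; apply: le_trans (ler_normB _ _) _.
  by rewrite normr_id (gtr0_norm (z_gt0 t w)).
have adapt t : adapted xi t (x t) /\ adapted xi t (y t).
  elim: t => [|t [ax ay]].
    split; first by apply: adapted_ext _ (adapted_cst x0).
    by apply: adapted_ext _ (adapted_cst y0).
  have {}ax := adaptedS ax; have {}ay := adaptedS ay.
  have axi := @adapted_xi _ _ _ _ xi t.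
  have ae := adaptedB ax ay; split.
    apply: adapted_ext _ (adaptedB (adaptedB ax (adaptedM (adapted_cst (alpha t)) ae))
      (adaptedM (adapted_cst (alpha t)) axi)) => w.
    by rewrite hx /F; ring.
  (* With the sign frozen at [s], the update of [y] uses only differences, products and the norm. *)
  apply: adapted_ext _ (adaptedB ay (adaptedM (adapted_cst (beta t))
    (adaptedB ay (adaptedM (adapted_norm ae) (adapted_cst s))))) => w.
  by rewrite ySE.
have am t : adapted xi t (m t).
  have [ax ay] := adapt t; have ae := adaptedB ax ay.
  apply: adapted_ext _ (adaptedB (adaptedM (adapted_cst (1 - alpha t)) ae)
    (adaptedM (adapted_cst (- beta t))
      (adaptedB ay (adaptedM (adapted_norm ae) (adapted_cst s))))) => w.
  by rewrite /m /e; ring.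
have Exi2 t : (\int[P]_w (xi t w ^+ 2)%:E = Sigma1%:E)%E.
  by have := hxi_var t; rewrite unlock.
have sxi t : sqint P (xi t).
  split => //; apply/integrableP; split.
    by apply/measurable_EFinP; exact: measurable_funX.
  by under eq_integral do rewrite /= ger0_norm ?sqr_ge0//; rewrite Exi2 ltry.
(* One level [M], chosen for [xi 0], serves all times since the laws coincide. *)
have [M M0 trM] : exists2 M : R, 0 <= M & Sigma1 / 2 <= \int[P]_w trunc_sqr M (xi 0%N w).
  by apply: truncated_moment (Exi2 0%N) _; lra.
have [xO yO] : is_Omega (fun t => \int[P]_w (e t w ^+ 2)) alpha /\
    is_Omega (fun t => \int[P]_w (z t w ^+ 2)) alpha.
  have cst0 : (e 0%N = cst (x0 - y0)) /\ (z 0%N = cst (s * y0)).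
    by split; apply/funext => w; rewrite /e /z ?hx0 hy0.
  apply: (second_moments_ge (m := m) (X := fun t => xi t) (S := Sigma1) (M := M)
     (b := beta)) => //.
  - by move=> t; exact: (a_slow t).1.
  - by move=> t; exact: (a_slow t).2.
  - by move=> t; have := hxi_mean t; rewrite unlock /Rintegral => ->.
  - by move=> t; rewrite /Rintegral Exi2.
  - move=> t; apply: le_trans trM _.
    rewrite (identically_distributed_Rintegral 0%N t hid)//.
      exact: measurable_trunc_sqr.
    exact: trunc_sqr_ge0.
  - by move=> t; exact: adapted_measurable (am t).
  - by move=> t; have := adapted_indep hindep (am t).
  - by rewrite cst0.1; exact: sqint_cst.
  - by rewrite cst0.2; exact: sqint_cst.
  (* [z 0] is constant, so its positivity at one sample point is that of its mean. *)
  - rewrite cst0.2 Rintegral_probability_cst; have := z_gt0 0%N point.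
    by rewrite cst0.2.
  - by move=> t w; exact: ltW.
  - by move=> t; apply/funext => w; rewrite eS.
  - by move=> t; apply/funext => w; rewrite zS.
split.
- have [c c0 [t0 h]] := xO; exists c => //; exists t0 => t t0t.
  apply: le_trans (h t t0t) _; rewrite /mean_square unlock.
  by under [X in _ <= fine X]eq_integral do rewrite /H real_normK ?num_real//.
- have [c c0 [t0 h]] := yO; exists c => //; exists t0 => t t0t.
  apply: le_trans (h t t0t) _; rewrite /mean_square unlock.
  under [X in _ <= fine X]eq_integral do rewrite /ystar subr0 real_normK ?num_real//.
  (* [y] and [z] have the same square because [s * s = 1]. *)
  under eq_Rintegral do rewrite /z exprMn expr2 ss mul1r.
  exact: lexx.
Qed.
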